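(* For all countable ordinals $\xi\ge 1$ we have \[ \mathrm{rbc}(\xi)\le\xi+1\quad\text{and}\quad\mathrm{apb}(\xi)\le\xi+2 . \]
   Context: Notation. $\omega=\{0,1,2,\dots\}$, $\omega_1$ is the first uncountable ordinal, $\mathcal{N}=\omega^\omega$ is the Baire space with the product topology. For $\alpha\in\mathcal{N}$, $\alpha^\ast=(i\mapsto\alpha(i+1))$. $\boldsymbol{\Pi}^0_\xi$ ($1\le\xi<\omega_1$) are the usual multiplicative Borel classes. Coding of finite sequences. For $n\ge 1$, $\langle u_0,\dots,u_{n-1}\rangle=p_0^{u_0+1}\cdots p_{n-1}^{u_{n-1}+1}$, where $p_0<p_1<\dots$ are the primes; $\langle\emptyset\rangle=1$. If $s=\langle u_0,\dots,u_{n-1}\rangle$ and $i<n$, then $(s)_i:=u_i$; if $i\ge n$ or $s$ is not in the image of $\langle\cdot\rangle$, then $(s)_i:=0$. Put $q_k=(k)_0/((k)_1+1)$. Basic open sets. For $\mathcal{X}=\mathcal{N}$ and $\mathcal{X}=\omega\times\omega$ a compatible metric $d_{\mathcal{X}}$ and a dense sequence $(r^{\mathcal{X}}_i)_{i\in\omega}$ (forming a recursive presentation) are fixed, and $N(\mathcal{X},s)$ is the open $d_{\mathcal{X}}$-ball with center $r^{\mathcal{X}}_{(s)_0}$ and radius $q_{(s)_1}$ (empty if the radius is $0$). For $\mathcal{N}$ the choice is: $d_{\mathcal{N}}(\alpha,\beta)=(n+1)^{-1}$ with $n$ least such that $\alpha(n)\ne\beta(n)$ if $\alpha\ne\beta$,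 $d_{\mathcal{N}}(\alpha,\alpha)=0$, and $r^{\mathcal{N}}_s(i)=(s)_i$. Define $\mathrm{U}^{\omega\times\omega}(\alpha,x)\iff(\exists k\in\omega)[x\in N(\omega\times\omega,\alpha(k))]$ for $\alpha\in\mathcal{N}$, $x\in\omega\times\omega$. Partial functions $\{\alpha\}$. For $\alpha\in\mathcal{N}$ let $\{\alpha\}:\omega\rightharpoonup\mathcal{N}$ be the partial function such that $\{\alpha\}(n)$ is defined (written $\{\alpha\}(n)\downarrow$) exactly when there is a unique $\beta\in\mathcal{N}$ such that for all $s\in\omega$: $\beta\in N(\mathcal{N},s)\iff\mathrm{U}^{\omega\times\omega}(\alpha,(n,s))$; in that case $\{\alpha\}(n)$ is this $\beta$. Borel codes. Define $\mathrm{BC}_\xi\subseteq\mathcal{N}$ for $\xi<\omega_1$ by recursion: $\alpha\in\mathrm{BC}_0\iff\alpha(0)=0$; and for $\xi\ge 1$, $\alpha\in\mathrm{BC}_\xi\iff\alpha(0)=1$ and for every $n$ there is $\zeta<\xi$ with $\{\alpha^\ast\}(n)\downarrow$ and $\{\alpha^\ast\}(n)\in\mathrm{BC}_\zeta$. The functions $\mathrm{rbc},\mathrm{apb}:\omega_1\setminus\{0\}\to\omega_1\setminus\{0\}$. $\mathrm{rbc}(\xi)$ is the least $\eta<\omega_1$ such that $\mathrm{BC}_\xi$ is a $\boldsymbol{\Pi}^0_\eta$ subset of $\mathcal{N}$. $\mathrm{apb}(1)=1$, and for $\xi>1$, $\mathrm{apb}(\xi)=\sup\{\max\{\mathrm{apb}(\eta),\mathrm{rbc}(\eta)+1\}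 : 1\le\eta<\xi\}+1$. *)

(* Defs.v *)
From HB Require Import structures.
From mathcomp Require Import all_boot all_order all_algebra.
From mathcomp Require Import all_classical all_reals all_analysis.
From mathcomp Require wochoice.
Set Implicit Arguments.
Unset Strict Implicit.
Unset Printing Implicit Defensive.
Import Order.TTheory GRing.Theory Num.Theory.
Local Open Scope classical_set_scope.
Local Open Scope order_scope.

(** * Countable ordinals *)

Definition cwo : rel (nat -> bool) :=
  sval (wochoice.well_ordering_principle (nat -> bool)).

Lemma cwoP : wochoice.well_order cwo.
Proof. exact: svalP (wochoice.well_ordering_principle _). Qed.

(** [omega1] consists of the points with countably many predecessors in a
    well-ordering of the continuum. The lemmas [omega1_wf], [omega1_countable]
    and [omega1_uncountable] below determine its order type. *)
Record omega1 := Omega1 {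
  omega1_val : nat -> bool;
  omega1_valP : `[< countable [set y | cwo y omega1_val] >] }.

HB.instance Definition _ := [isSub for omega1_val].
HB.instance Definition _ := [Choice of omega1 by <:].

Fact omega1_display : Order.disp_t. Proof. exact: (Order.Disp tt tt). Qed.

Definition omega1_le (x y : omega1) := cwo (val x) (val y).

Lemma cwo_total : total cwo.
Proof.
move=> x y.
by have := wochoice.wo_chainW (wochoice.withinW cwoP (A := predT)); apply.
Qed.

Lemma cwo_refl : reflexive cwo.
Proof. by move=> x; have := cwo_total x x; rewrite orbb. Qed.

Lemma cwo_anti : antisymmetric cwo.
Proof.
move=> x y.
have := wochoice.wo_chain_antisymmetric (wochoice.withinW cwoP (A := predT)).
exact.
Qed.

Lemma cwo_min (A : set (nat -> bool)) : A !=set0 ->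
  exists2 x, A x & forall y, A y -> cwo x y.
Proof.
move=> [x Ax].
have [|z [[zA zmin] _]] := cwoP (A := fun x => `[< A x >]).
  by exists x; apply/asboolP.
exists z; first exact/asboolP.
by move=> y Ay; apply: zmin; apply/asboolP.
Qed.

Lemma cwo_trans : transitive cwo.
Proof.
move=> y x z xy yz.
have [|t] := @cwo_min [set t | t = x \/ t = y \/ t = z]; first by exists x; left.
move=> tE tmin.
have tx : cwo t x by apply: tmin; left.
have ty : cwo t y by apply: tmin; right; left.
have tz : cwo t z by apply: tmin; right; right.
case: tE => [<- //|[tE|tE]].
- by have -> : x = y by apply: cwo_anti; rewrite xy -tE tx.
- by have <- : y = z by apply: cwo_anti; rewrite yz -tE ty.
Qed.

Lemma omega1_le_refl : reflexive omega1_le.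
Proof. by move=> x; exact: cwo_refl. Qed.

Lemma omega1_le_anti : antisymmetric omega1_le.
Proof. by move=> x y /cwo_anti/val_inj. Qed.

Lemma omega1_le_trans : transitive omega1_le.
Proof. by move=> y x z; exact: cwo_trans. Qed.

HB.instance Definition _ := Order.Le_isPOrder.Build omega1_display omega1
  omega1_le_refl omega1_le_anti omega1_le_trans.

Lemma omega1_le_total : total (<=%O : rel omega1).
Proof. by move=> x y; exact: cwo_total. Qed.

HB.instance Definition _ :=
  Order.POrder_isTotal.Build omega1_display omega1 omega1_le_total.

Lemma omega1_uncountable : ~ countable [set: omega1].
Proof.
move=> cO.
have cim : countable [set x | countable [set y | cwo y x]].
  apply: (@sub_countable _ _ _ (val @` [set: omega1])).
    apply: subset_card_le => x cx.
    by exists (Omega1 (asboolT cx)).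
  exact: sub_countable (card_image_le _ _) cO.
have [allc|] := pselect (forall x, countable [set y | cwo y x]).
  have : countable [set: nat -> bool].
    by apply: sub_countable cim; apply: subset_card_le => x _; exact: allc.
  case/countable_injP => f finj.
  pose D n := ~~ `[< exists2 x : nat -> bool, f x = n & x n >].
  have DE : D (f D) <-> ~ exists2 x : nat -> bool, f x = f D & x (f D).
    by rewrite /D; split=> [/asboolPn|?] //; apply/asboolPn.
  have nDD : ~ D (f D) by move=> DD; case/DE: (DD); exists D.
  apply: (nDD); apply/DE => -[x fx xfD].
  have xD : x = D by apply: finj; rewrite ?inE.
  by rewrite xD in xfD.
move=> /existsNP/cwo_min[x xnc xmin]; apply: xnc.
have cU : countable ([set x] `|` [set x | countable [set y | cwo y x]]).
  by rewrite -bigcup2E; apply: bigcup_countable => // -[|[|n]] _ //=.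
apply: sub_countable cU; apply: subset_card_le => y /= yx.
have [|nyc] := pselect (countable [set z | cwo z y]); first by right.
by left; apply: cwo_anti; rewrite yx xmin.
Qed.

Lemma omega1_min (A : set omega1) : A !=set0 ->
  exists x, A x /\ lbound A x.
Proof.
move=> [x Ax]; have [|z [y Ay <-] zmin] := @cwo_min (val @` A).
  by exists (val x), x.
by exists y; split=> // t At; apply: zmin; exists t.
Qed.

Lemma omega1_countable (x : omega1) : countable [set y | y <= x].
Proof.
have /asboolP cx := omega1_valP x.
apply/countable_injP; have /countable_injP[f finj] := cx.
exists (f \o val) => y z; rewrite !inE => yx zx /finj fyz.
by apply: val_inj; apply: fyz; rewrite inE.
Qed.

Lemma omega1_wf : well_founded (<%O : omega1 -> omega1 -> Prop).
Proof.
move=> x; apply: contrapT => nx.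
have [|y [nAy ymin]] := @omega1_min [set y | ~ Acc <%O y]; first by exists x.
apply: nAy; constructor => z zy; apply: contrapT => /ymin.
by rewrite leNgt zy.
Qed.

Lemma omega1_inhabited : exists x : omega1, lbound setT x.
Proof.
have [|x [_ xmin]] := @omega1_min setT; last by exists x.
apply/set0P/eqP => O0; apply: omega1_uncountable.
by rewrite O0; exact: countable0.
Qed.

Definition omega1_bot : omega1 := sval (cid omega1_inhabited).

Lemma omega1_botP x : omega1_bot <= x.
Proof. exact: (svalP (cid omega1_inhabited)). Qed.

HB.instance Definition _ :=
  Order.hasBottom.Build omega1_display omega1 omega1_botP.

(** Least element of [A], and the junk value [\bot] if [A] is empty. *)
Definition oleast (A : set omega1) : omega1 :=
  xget \bot [set x | A x /\ lbound A x].

Definition osucc (x : omega1) : omega1 := oleast [set y | x < y].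

Definition osup (A : set omega1) : omega1 := oleast (ubound A).

Definition ozero : omega1 := \bot.
Definition oone : omega1 := osucc ozero.

Lemma oleastP A : A !=set0 -> A (oleast A) /\ lbound A (oleast A).
Proof. by move=> /omega1_min[x Px]; rewrite /oleast; case: xgetP => // /(_ x). Qed.

Lemma omega1_bounded (A : set omega1) : countable A -> ubound A !=set0.
Proof.
move=> cA; apply: contrapT => nA; apply: omega1_uncountable.
have cU : countable (\bigcup_(a in A) [set y | y <= a]).
  by apply: bigcup_countable => // a _; exact: omega1_countable.
apply: sub_countable cU; apply: subset_card_le => x _; apply: contrapT => nx.
apply: nA; exists x => a Aa; apply: contrapT => /negP; rewrite -ltNge => xa.
by apply: nx; exists a => //=; exact: ltW.
Qed.

Lemma osuccP x : x < osucc x /\ forall y, x < y -> osucc x <= y.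
Proof.
apply: oleastP; apply: contrapT => nx.
apply: omega1_uncountable; apply: sub_countable (omega1_countable x).
apply: subset_card_le => y _ /=; rewrite leNgt; apply/negP => xy.
by apply: nx; exists y.
Qed.

Lemma osupP (A : set omega1) : countable A ->
  ubound A (osup A) /\ forall y, ubound A y -> osup A <= y.
Proof. by move=> /omega1_bounded/oleastP. Qed.

(** * Borel classes *)

(** [Sigma0 xi] is empty for [xi = 0]. *)
Inductive Sigma0 (T : topologicalType) : omega1 -> set T -> Prop :=
| Sigma0_open A : open A -> Sigma0 oone A
| Sigma0_bigcup (xi : omega1) (zeta : nat -> omega1) (A : nat -> set T) :
    oone < xi -> (forall n, oone <= zeta n < xi) ->
    (forall n, Sigma0 (zeta n) (~` A n)) ->
    Sigma0 xi (\bigcup_n A n).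

Definition Pi0 (T : topologicalType) (xi : omega1) (A : set T) : Prop :=
  Sigma0 xi (~` A).

(** * Coding of finite sequences *)

Lemma prime_gtn (m : nat) : exists p, prime p && (m < p)%N.
Proof. by have [p mp pp] := prime_above m; exists p; rewrite pp. Qed.

Fixpoint nth_prime (i : nat) : nat :=
  if i is j.+1 then ex_minn (prime_gtn (nth_prime j)) else 2.

Definition seq_code (u : seq nat) : nat :=
  (\prod_(i < size u) nth_prime i ^ (nth 0 u i).+1)%N.

(** [seq_code] is injective; [xget] returns [[::]] off its range and [nth]
    returns [0] beyond the length. *)
Definition seq_decode (s i : nat) : nat :=
  nth 0%N (xget [::] [set u | seq_code u = s]) i.

(** * Recursive presentations *)

(** The total recursive functions: minimization is applied to regular functions
    only. *)
Inductive recursive_fun : forall n, (n.-tuple nat -> nat) -> Prop :=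
| rec_zero n : recursive_fun (fun _ : n.-tuple nat => 0%N)
| rec_succ : recursive_fun (fun t : 1.-tuple nat => (thead t).+1)
| rec_proj n (i : 'I_n) : recursive_fun (fun t : n.-tuple nat => tnth t i)
| rec_comp m n (f : m.-tuple nat -> nat) (g : 'I_m -> n.-tuple nat -> nat) :
    recursive_fun f -> (forall i, recursive_fun (g i)) ->
    recursive_fun (fun t => f [tuple g i t | i < m])
| rec_prim n (f : n.-tuple nat -> nat) (g : n.+2.-tuple nat -> nat) :
    recursive_fun f -> recursive_fun g ->
    recursive_fun (fun t : n.+1.-tuple nat =>
      nat_rect (fun _ => nat) (f [tuple of behead t])
        (fun k y => g [tuple of k :: y :: behead t]) (thead t))
| rec_min n (f : n.+1.-tuple nat -> nat)
    (freg : forall t : n.-tuple nat, exists k, f [tuple of k :: t] == 0%N) :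
    recursive_fun f -> recursive_fun (fun t => ex_minn (freg t)).

Definition recursive_rel n (P : n.-tuple nat -> Prop) : Prop :=
  recursive_fun (fun t => nat_of_bool `[< P t >]).

Local Open Scope ring_scope.

Record recursive_presentation (R : realType) (X : topologicalType)
    (d : X -> X -> R) (r : nat -> X) : Prop := RecursivePresentation {
  pres_eq0 : forall x y, d x y = 0 <-> x = y;
  pres_sym : forall x y, d x y = d y x;
  pres_triangle : forall x y z, d x z <= d x y + d y z;
  pres_compatible : forall (x : X) (A : set X),
    nbhs x A <-> exists2 e : R, 0 < e & [set y | d x y < e] `<=` A;
  pres_dense : dense (range r);
  (* the arguments are (i, j, m, k) *)
  pres_rec_le : recursive_rel (fun t : 4.-tuple nat =>
    d (r (tnth t 0)) (r (tnth t 1)) <= (tnth t 2)%:R / (tnth t 3).+1%:R);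
  pres_rec_lt : recursive_rel (fun t : 4.-tuple nat =>
    d (r (tnth t 0)) (r (tnth t 1)) < (tnth t 2)%:R / (tnth t 3).+1%:R) }.

Definition qrat (R : realType) (k : nat) : R :=
  (seq_decode k 0)%:R / (seq_decode k 1).+1%:R.

Definition basic_open (R : realType) (X : Type) (d : X -> X -> R)
    (r : nat -> X) (s : nat) : set X :=
  [set x | d (r (seq_decode s 0)) x < qrat R (seq_decode s 1)].

(** * The Baire space *)

Definition baire : topologicalType := prod_topology (fun _ : nat => nat).

Definition dbaire (R : realType) (a b : baire) : R :=
  if pselect (exists n, a n != b n) is left h then (ex_minn h).+1%:R^-1 else 0.

Definition rbaire (s : nat) : baire := fun i => seq_decode s i.

Definition bshift (a : baire) : baire := fun i => a i.+1.

(** * Borel codes *)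

Section BorelCodes.
(* the presentation of [nat * nat] *)
Variables (R : realType) (d : nat * nat -> nat * nat -> R)
  (r : nat -> nat * nat).

Definition univ_open (a : baire) (x : nat * nat) : Prop :=
  exists k, basic_open d r (a k) x.

(** Graph of the partial function [{a}]. *)
Definition kapp (a : baire) (n : nat) (b : baire) : Prop :=
  unique (fun b : baire => forall s,
    basic_open (@dbaire R) rbaire s b <-> univ_open a (n, s)) b.

(** The recursion on [xi] has a unique solution by [omega1_wf]; being
    well-founded, it is given here by its graph. *)
Inductive BC : omega1 -> set baire :=
| BC_zero (a : baire) : a 0%N = 0%N -> BC ozero a
| BC_pos (xi : omega1) (a : baire) :
    (oone <= xi)%O -> a 0%N = 1%N ->
    (forall n, exists2 zeta, (zeta < xi)%O &
       exists2 b, kapp (bshift a) n b & BC zeta b) ->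
    BC xi a.

(** Meaningful only if some [eta] qualifies; otherwise this is the junk value
    of [oleast]. *)
Definition rbc (xi : omega1) : omega1 :=
  oleast [set eta | Pi0 eta (BC xi)].

(** [rbc] and [apb] are only meant for arguments [xi >= 1]. *)
Definition apb_step (xi : omega1)
    (rec : forall eta : omega1, (eta < xi)%O -> omega1) : omega1 :=
  if xi == oone then oone else
  osucc (osup [set theta | exists eta (h : (eta < xi)%O),
    (oone <= eta)%O /\ theta = Order.max (rec eta h) (osucc (rbc eta))]).

Definition apb : omega1 -> omega1 :=
  Fix omega1_wf (fun _ => omega1) apb_step.

Lemma apbE xi : apb xi = apb_step (fun eta (_ : (eta < xi)%O) => apb eta).
Proof.
rewrite /apb Fix_eq // => x f g fg; congr apb_step.
by apply: functional_extensionality_dep => y;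
  apply: functional_extensionality_dep => h; exact: fg.
Qed.

Lemma apb_one : apb oone = oone.
Proof. by rewrite apbE /apb_step eqxx. Qed.

Lemma apb_gt1 xi : (oone < xi)%O -> apb xi =
  osucc (osup [set Order.max (apb eta) (osucc (rbc eta))
                | eta in [set eta | (oone <= eta)%O /\ (eta < xi)%O]]).
Proof.
move=> xi1; rewrite apbE /apb_step gt_eqF //; congr (osucc (osup _)).
apply/seteqP; split=> [_ [eta [h [h1 ->]]]|_ [eta [h1 h] <-]] /=.
  by exists eta.
by exists eta, h.
Qed.

End BorelCodes.

(* Main.v *)
(** By induction, [BC xi] is [Pi0 (osucc xi)] for every [xi]. The domain of
    [a |-> {a}(n)] is a G_delta set, and on it this map is continuous. So the
    induction step reduces to the class of [V], the union of the [BC z] with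
    [z < xi]: if [xi] is a limit, [V] is a countable union of sets of class
    [Pi0 (osucc z)] with [osucc z < xi], hence [Sigma0 xi]; if [xi = osucc e]
    with [e > 0], monotonicity gives [V = BC 0 `|` BC e], which is [Pi0 xi]; and
    for [xi = 1], [V = BC 0] is open. In all cases [V] is [Pi0 (osucc xi)], and
    so is [BC xi], which is defined by a countable intersection. The
    bound on [apb] follows by induction from the one on [rbc]. *)
Require Import Defs.
From mathcomp Require Import all_boot all_order all_algebra.
From mathcomp Require Import all_classical all_reals all_analysis.
Import Order.TTheory GRing.Theory Num.Theory.
Local Open Scope order_scope.
Local Open Scope classical_set_scope.

(** * Successors of countable ordinals *)

Lemma lt_osucc (x : omega1) : x < osucc x.
Proof. by case: (osuccP x). Qed.

Lemma osucc_le (x y : omega1) : x < y -> osucc x <= y.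
Proof. by case: (osuccP x) => _; exact. Qed.

Lemma lt_osuccE (x y : omega1) : (x < osucc y) = (x <= y).
Proof.
apply/idP/idP => [xy|xy]; last exact: le_lt_trans xy (lt_osucc y).
by rewrite leNgt; apply/negP => /osucc_le; rewrite leNgt xy.
Qed.

Lemma osucc_mono (x y : omega1) : x <= y -> osucc x <= osucc y.
Proof. by move=> xy; apply: osucc_le; rewrite lt_osuccE. Qed.

Lemma oone_le (x : omega1) : (oone <= x) = (ozero < x).
Proof.
apply/idP/idP => [|/osucc_le //].
exact: lt_le_trans (lt_osucc ozero).
Qed.

Lemma oone_le_osucc (x : omega1) : oone <= osucc x.
Proof. by rewrite oone_le (le_lt_trans _ (lt_osucc x)) // omega1_botP. Qed.

(** * Closure properties of the Borel classes *)

Section Sigma0Theory.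
Context {T : topologicalType}.
Implicit Types (x z : omega1) (A C : set T).

Lemma Sigma0_ge1 x A : Sigma0 x A -> oone <= x.
Proof. by case=> // xi zeta B /ltW. Qed.

Lemma Sigma0_setC z x A : z < x -> Sigma0 z (~` A) -> Sigma0 x A.
Proof.
move=> zx SA; have z1 := Sigma0_ge1 _ _ SA.
have -> : A = \bigcup_(n : nat) A by rewrite bigcup_const //; exists 0%N.
by apply: (@Sigma0_bigcup _ _ (fun=> z)) => [|n|//];
  [exact: le_lt_trans zx|rewrite z1].
Qed.

Lemma Sigma0_gt1 x A : oone < x -> Sigma0 x A ->
  exists (zeta : nat -> omega1) (B : nat -> set T),
    [/\ forall n, oone <= zeta n < x, forall n, Sigma0 (zeta n) (~` B n)
      & A = \bigcup_n B n].
Proof.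
move=> x1 SA; case: SA x1 => [B _|xi zeta B _ hz hB _]; first by rewrite ltxx.
by exists zeta, B.
Qed.

(** Level [oone] is excluded for [z]: leaving it would require open sets to be F_sigma, which fails
    in general spaces. *)
Lemma Sigma0_le z x A : oone < z -> z <= x -> Sigma0 z A -> Sigma0 x A.
Proof.
move=> z1 zx /Sigma0_gt1[//|zeta [B [hz hB ->]]].
apply: (@Sigma0_bigcup _ _ zeta) => //; first exact: lt_le_trans zx.
by move=> n; case/andP: (hz n) => -> /= h; exact: lt_le_trans zx.
Qed.

Lemma Sigma0_bigcup_nat x (A : nat -> set T) : oone < x ->
  (forall n, Sigma0 x (A n)) -> Sigma0 x (\bigcup_n A n).
Proof.
move=> x1 SA.
have /choice[z hz] : forall n, exists p : (nat -> omega1) * (nat -> set T),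
    [/\ forall m, oone <= p.1 m < x, forall m, Sigma0 (p.1 m) (~` p.2 m)
      & A n = \bigcup_m p.2 m].
  move=> n; have [zeta [B hB]] := Sigma0_gt1 _ _ x1 (SA n).
  by exists (zeta, B).
(* The double union is reindexed along codes of pairs; the default [(0, 0)] only repeats a set
   already present. *)
pose u k : nat * nat := odflt (0, 0)%N (unpickle k).
have -> : \bigcup_n A n = \bigcup_k (z (u k).1).2 (u k).2.
  apply/seteqP; split=> [a [n _]|a [k _ ha]].
    case: (hz n) => _ _ -> [m _ ha]; exists (pickle (n, m)) => //.
    by rewrite /u pickleK.
  exists (u k).1 => //; case: (hz (u k).1) => _ _ ->.
  by exists (u k).2.
apply: (@Sigma0_bigcup _ _ (fun k => (z (u k).1).1 (u k).2)) => // k;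
by case: (hz (u k).1).
Qed.

Lemma Sigma0_set0 x : oone < x -> Sigma0 x (@set0 T).
Proof.
move=> x1; apply: Sigma0_setC x1 _; rewrite setC0.
by apply: Sigma0_open; exact: openT.
Qed.

Lemma Pi0_forall (I : countType) x (P : I -> T -> Prop) : oone < x ->
  (forall i, Pi0 x [set a | P i a]) -> Pi0 x [set a | forall i, P i a].
Proof.
move=> x1 hP; rewrite /Pi0.
pose B n : set T := if unpickle n is Some i then ~` [set a | P i a] else set0.
rewrite [X in Sigma0 _ X](_ : _ = \bigcup_n B n); last first.
  apply/seteqP; split=> [a /existsNP[i nPi]|a [n _]].
    by exists (pickle i) => //; rewrite /B pickleK.
  by rewrite /B; case: (unpickle n) => // i nPi /(_ i).
apply: Sigma0_bigcup_nat => // n; rewrite /B.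
by case: (unpickle n) => [i|]; [exact: hP|exact: Sigma0_set0].
Qed.

Lemma Pi0_and x (P Q : T -> Prop) : oone < x ->
  Pi0 x [set a | P a] -> Pi0 x [set a | Q a] -> Pi0 x [set a | P a /\ Q a].
Proof.
move=> x1 hP hQ.
have -> : [set a | P a /\ Q a] =
    [set a | forall b : bool, (if b then P else Q) a].
  apply/seteqP; split=> [a [Pa Qa] []//|a h].
  by split; [exact: (h true)|exact: (h false)].
by apply: Pi0_forall => // -[].
Qed.

Lemma open_Pi0 x A : oone < x -> open A -> Pi0 x A.
Proof.
by move=> x1 oA; apply: Sigma0_setC x1 _; rewrite setCK; exact: Sigma0_open.
Qed.

Lemma Sigma0_clopen x A : Sigma0 x A -> forall C, clopen C ->
  Sigma0 x (A `&` C) /\ Sigma0 x (A `|` C).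
Proof.
elim=> [B oB|xi zeta B xi1 hz _ IH] C cC.
  have [oC _] := cC.
  by split; apply: Sigma0_open; [exact: openI|exact: openU].
have cC' : clopen (~` C) by apply: clopenC.
split.
  rewrite setI_bigcupl; apply: (@Sigma0_bigcup _ _ zeta) => // n.
  by rewrite setCI; case: (IH n _ cC').
rewrite -bigcupUl; last by exists 0%N.
apply: (@Sigma0_bigcup _ _ zeta) => // n.
by rewrite setCU; case: (IH n _ cC').
Qed.

End Sigma0Theory.

(* [G] is the graph of a partial function, continuous on its domain. *)
Lemma Sigma0_preimage {T U : topologicalType} (G : T -> U -> Prop) :
  (forall O : set U, open O -> exists2 W : set T, open W &
     forall a b, G a b -> (O b <-> W a)) ->
  forall x (A : set U), Sigma0 x A -> exists2 B : set T, Sigma0 x B &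
     forall a b, G a b -> (A b <-> B a).
Proof.
move=> hG x A; elim=> [B /hG[W oW h]|xi zeta B xi1 hz _ IH].
  by exists W => //; exact: Sigma0_open.
have /choice[C hC] : forall n, exists C : set T, Sigma0 (zeta n) C /\
    forall a b, G a b -> ((~` B n) b <-> C a).
  by move=> n; have [C ? ?] := IH n; exists C.
exists (\bigcup_n ~` C n).
  by apply: (@Sigma0_bigcup _ _ zeta) => // n; rewrite setCK; case: (hC n).
move=> a b Gab; split=> -[n _ h]; exists n => //.
  by move=> Ca; have [_ /(_ _ _ Gab)[_ /(_ Ca)]] := hC n.
apply: contrapT => nB; apply: h.
by have [_ /(_ _ _ Gab)[/(_ nB)]] := hC n.
Qed.

Lemma Pi0_preimage {T U : topologicalType} (G : T -> U -> Prop) :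
  (forall O : set U, open O -> exists2 W : set T, open W &
     forall a b, G a b -> (O b <-> W a)) ->
  forall x (A : set U), Pi0 x A -> exists2 B : set T, Pi0 x B &
     forall a b, G a b -> (A b <-> B a).
Proof.
move=> hG x A /(Sigma0_preimage G hG)[B SB hB].
exists (~` B); first by rewrite /Pi0 setCK.
move=> a b /hB[h1 h2]; suff : A b <-> ~ B a by [].
split=> [Ab|nB]; first by move/h2.
by apply: contrapT => nA; apply: nB; exact: h1.
Qed.

(** * Injectivity of the coding of sequences *)

Lemma nth_prime_prime i : prime (nth_prime i).
Proof. by case: i => [//|i] /=; case: ex_minnP => p /andP[]. Qed.

Lemma nth_prime_ltS i : (nth_prime i < nth_prime i.+1)%N.
Proof. by rewrite /=; case: ex_minnP => p /andP[]. Qed.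

Lemma nth_prime_inj : injective nth_prime.
Proof.
have mono : {homo nth_prime : i j / (i < j)%N >-> (i < j)%N}.
  by apply: homo_ltn nth_prime_ltS; exact: ltn_trans.
by move=> i j ij; case: (ltngtP i j) => // /mono; rewrite ij ltnn.
Qed.

Lemma logn_prod (I : Type) (l : seq I) (P : pred I) (F : I -> nat) p :
  (forall i, P i -> (0 < F i)%N) ->
  logn p (\prod_(i <- l | P i) F i)%N = (\sum_(i <- l | P i) logn p (F i))%N.
Proof.
move=> F0; have : (0 < \prod_(i <- l | P i) F i)%N by exact: prodn_cond_gt0.
elim/big_rec2: _ => [|i m n Pi IH]; first by rewrite logn1.
by rewrite muln_gt0 => /andP[Fi n0]; rewrite lognM // IH.
Qed.

(** Exponents are entries plus one, so valuation zero marks the end of [u]: the length is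
    recoverable too. *)
Lemma logn_seq_code u i : logn (nth_prime i) (seq_code u) =
  if (i < size u)%N then (nth 0%N u i).+1 else 0%N.
Proof.
rewrite logn_prod => [|j _]; last first.
  by rewrite expn_gt0 prime_gt0 ?nth_prime_prime.
under eq_bigr do
  rewrite lognX logn_prime ?nth_prime_prime // (inj_eq nth_prime_inj).
case: ifPn => [iu|]; last rewrite -leqNgt => ui.
  rewrite (bigD1 (Ordinal iu)) //= eqxx muln1 big1 ?addn0 // => j.
  by rewrite -val_eqE eq_sym => /negbTE /= ->; rewrite muln0.
by rewrite big1 // => j _; rewrite gtn_eqF ?muln0 // (leq_trans (ltn_ord j)).
Qed.

Lemma seq_code_inj : injective seq_code.
Proof.
move=> u v uv.
have E i := etrans (esym (logn_seq_code u i))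
  (etrans (congr1 (logn (nth_prime i)) uv) (logn_seq_code v i)).
have suv : size u = size v.
  by case: (ltngtP (size u) (size v)) => // h;
    [have := E (size u)|have := E (size v)]; rewrite h ltnn.
apply: (@eq_from_nth _ 0%N) => // i iu.
by have := E i; rewrite -suv iu => -[].
Qed.

Lemma seq_codeK u i : seq_decode (seq_code u) i = nth 0%N u i.
Proof.
by rewrite /seq_decode; case: xgetP => [v _ /seq_code_inj -> //|/(_ u)[]].
Qed.

(** * Balls and cylinders of the Baire space *)

Section Baire.
Variable R : realType.
Implicit Types (a b c : baire) (s m : nat).

Local Notation N := (basic_open (@dbaire R) rbaire).

Lemma dbaire_ge0 a b : (0 <= dbaire R a b)%R.
Proof. by rewrite /dbaire; case: pselect => // h; rewrite invr_ge0 ler0n. Qed.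

Lemma dbaire_lt a b m :
  (dbaire R a b < m.+1%:R^-1)%R <-> forall i, (i <= m)%N -> a i = b i.
Proof.
rewrite /dbaire; case: pselect => [h|nh].
  case: ex_minnP => n nab nmin.
  rewrite ltf_pV2 ?posrE ?ltr0n // ltr_nat ltnS; split=> [mn i im|H].
    apply/eqP; apply: contrapT => /negP/nmin.
    by rewrite leqNgt (leq_ltn_trans im mn).
  by rewrite ltnNge; apply/negP => /H/eqP; rewrite (negbTE nab).
split=> [_ i _|_]; last by rewrite invr_gt0 ltr0n.
by apply/eqP; apply: contrapT => /negP ni; apply: nh; exists i.
Qed.

Lemma cylinder_basic_open b m :
  exists s, forall c, N s c <-> forall i, (i <= m)%N -> c i = b i.
Proof.
(* The centre is [b] cut after [m.+1] entries, and [[:: 1; m]] codes the radius 1/(m+1). *)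
exists (seq_code [:: seq_code (mkseq b m.+1); seq_code [:: 1; m]])%N => c.
rewrite /basic_open /qrat /=; do !rewrite seq_codeK /=.
rewrite mul1r dbaire_lt.
by split=> h i im; have := h i im; rewrite /rbaire seq_codeK nth_mkseq.
Qed.

Lemma dbaire_eq a b c m : a m != b m -> (forall i, (i <= m)%N -> c i = b i) ->
  dbaire R a c = dbaire R a b.
Proof.
move=> ab cb; rewrite /dbaire; case: pselect => [h|[]]; last first.
  by exists m; rewrite cb.
case: pselect => [h'|[]]; last by exists m.
case: ex_minnP => n nac nmin; case: ex_minnP => n' nab nmin'.
have nm : (n <= m)%N by apply: nmin; rewrite cb.
have nm' : (n' <= m)%N by exact: nmin'.
suff -> : n = n' by [].
by apply/eqP; rewrite eqn_leq nmin ?cb // nmin' // -cb.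
Qed.

(** Balls are clopen. Away from the centre the distance to it is locally constant; at the centre
    only the radius matters. *)
Lemma basic_open_locally_cst s b : exists m, forall c,
  (forall i, (i <= m)%N -> c i = b i) -> (N s c <-> N s b).
Proof.
have [[m xb]|/forallNP xb] :=
    pselect (exists m, rbaire (seq_decode s 0) m != b m).
  by exists m => c cb; rewrite /basic_open /= (dbaire_eq _ b c m).
have {}xb : rbaire (seq_decode s 0) = b.
  by apply/funext => m; apply/eqP; apply: contrapT => /negP; exact: xb.
rewrite /basic_open /= xb /qrat; move: (seq_decode s 1) => k.
(* Radius 0 gives the empty ball; a radius (p+1)/(m+1) is at least 1/(m+1), so agreement up to [m]
   suffices. *)
move: (seq_decode k 0) (seq_decode k 1) => [|p] m; exists m => c cb.
  by rewrite mul0r !ltNge !dbaire_ge0.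
have h a : (forall i, (i <= m)%N -> b i = a i) ->
    (dbaire R b a < p.+1%:R / m.+1%:R)%R.
  move/dbaire_lt/lt_le_trans; apply.
  by rewrite ler_peMl ?invr_ge0 ?ler0n // ler1n.
by split=> _; apply: h => // i /cb.
Qed.

End Baire.

Lemma open_cylinder (O : set baire) (b : baire) : open O -> O b ->
  exists m, forall c : baire, (forall i, (i <= m)%N -> c i = b i) -> O c.
Proof.
move=> oO Ob; apply: contrapT => /forallNP nO.
(* Otherwise points outside [O] agreeing with [b] ever further would converge to [b]. *)
have /choice[g hg] : forall m, exists c : baire,
    (forall i, (i <= m)%N -> c i = b i) /\ ~ O c.
  move=> m; have /existsNP[c /not_implyP[h1 h2]] := nO m.
  by exists c.
have gb : g @ \oo --> b.
  apply/cvg_sup => i A [_ [[B oB <-] Bb] BA]; exists i => // n /= im.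
  apply: BA => /=; case: (hg n) => h _; rewrite /proj h //.
have : \forall n \near \oo, O (g n).
  by apply: gb; apply: open_nbhs_nbhs.
by case=> n _ /(_ n (leqnn n)) /=; case: (hg n).
Qed.

Lemma open_coord (P : set nat) k : open [set a : baire | P (a k)].
Proof.
apply: (@open_comp _ _ (proj k : baire -> nat) P) => [a _|].
  exact: proj_continuous.
exact: discrete_open.
Qed.

Lemma clopen_coord (P : set nat) k : clopen [set a : baire | P (a k)].
Proof.
split; first exact: open_coord.
by rewrite -[X in closed X]setCK closedC; exact: (open_coord (~` P)).
Qed.

Lemma open_cst (T : topologicalType) (Q : Prop) : open [set _ : T | Q].
Proof.
have [q|nq] := pselect Q.
  by rewrite (_ : [set _ | Q] = setT); [exact: openT|apply/seteqP; split].
by rewrite (_ : [set _ | Q] = set0); [exact: open0|apply/seteqP; split].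
Qed.

Lemma open_imply (T : topologicalType) (A W : set T) :
  open (~` A) -> open W -> open [set a | A a -> W a].
Proof.
move=> oA oW; rewrite (_ : [set a | _] = ~` A `|` W); first exact: openU.
apply/seteqP; split=> a /=; last by case.
by move=> AW; have [/AW|] := pselect (A a); [right|left].
Qed.

(** * The partial functions coded by points *)

Section Kapp.
Variables (R : realType) (d : nat * nat -> nat * nat -> R)
  (r : nat -> nat * nat).
Implicit Types (a b : baire) (n : nat).

Local Notation N := (basic_open (@dbaire R) rbaire).
Local Notation U := (univ_open d r).

Lemma open_univ_open (x : nat * nat) : open [set a | U (bshift a) x].
Proof.
rewrite (_ : [set a | _] =
    \bigcup_k [set a : baire | basic_open d r (a k.+1) x]).
  by apply: bigcup_open => k _;
    exact: (open_coord (fun j => basic_open d r j x)).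
by apply/seteqP; split=> [a [k h]|a [k _ h]]; exists k.
Qed.

(** Uniqueness is automatic: cylinders are balls, so the balls around a point determine it. *)
Lemma kappP a n b : kapp d r a n b <-> forall s, N s b <-> U a (n, s).
Proof.
split=> [[]//|h]; split=> // b' h'.
apply/funext => i; have [s hs] := cylinder_basic_open R b i.
suff /hs/(_ i (leqnn i)) : N s b' by [].
by apply/h'/h/hs.
Qed.

(* The set of codes of all basic neighbourhoods of some point is characterized
   by three properties: it has arbitrarily small members, any two of its members
   meet, and it is upward closed. *)
Lemma kapp_domP a n : (exists b, kapp d r a n b) <->
  [/\ forall m, exists s, (exists b, forall c,
        N s c <-> forall i, (i <= m)%N -> c i = b i) /\ U a (n, s),
      forall s t, U a (n, s) -> U a (n, t) -> N s `&` N t !=set0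
    & forall s t, U a (n, s) -> N s `<=` N t -> U a (n, t)].
Proof.
split=> [[b /kappP h]|[h1 h2 h3]].
  split=> [m|s t /h bs /h bt|s t /h bs st]; last by apply/h/st.
    have [s hs] := cylinder_basic_open R b m.
    by exists s; split; [exists b|apply/h/hs].
  by exists b.
have /choice[s hs] := h1.
have /choice[g hg] : forall m, exists b, forall c,
    N (s m) c <-> forall i, (i <= m)%N -> c i = b i.
  by move=> m; case: (hs m).
have gE m m' i : (i <= m)%N -> (i <= m')%N -> g m i = g m' i.
  move=> im im'; have [_ Um] := hs m; have [_ Um'] := hs m'.
  by have [c [/hg <- // /hg <-]] := h2 _ _ Um Um'.
(* By [gE] the chosen cylinders are compatible, and the one numbered [i] already fixes coordinate
   [i]. *)
pose b : baire := fun i => g i i.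
have bE m c : N (s m) c <-> forall i, (i <= m)%N -> c i = b i.
  split=> [/hg h i im|h]; first by rewrite h // (gE m i).
  by apply/hg => i im; rewrite h // /b (gE m i).
(* Near [b], [N t] is all or nothing. If it contains [b], it includes a small member and upward
   closure applies; if it is a member, it meets a small one and hence contains [b]. *)
exists b; apply/kappP => t; have [m hm] := basic_open_locally_cst R t b.
split=> [bt|Ut].
  have [_ Um] := hs m; apply: h3 Um _ => c /bE cb.
  by apply/hm.
have [_ Um] := hs m.
by have [c [/hm + /bE cb]] := h2 _ _ Ut Um; exact.
Qed.

(** For fixed numerical parameters each of the three properties is an open condition on [a], so the
    domain is G_delta. *)
Lemma Pi0_kapp_dom x n : oone < x ->
  Pi0 x [set a | exists b, kapp d r (bshift a) n b].
Proof.
move=> x1.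
(* The existential quantifiers in the premises [U (bshift a) _] become universal
   ones over clopen conditions, so that open sets need not be F_sigma. *)
rewrite (_ : [set a | _] = [set a | (forall m, exists2 s, (exists b, forall c,
      N s c <-> forall i, (i <= m)%N -> c i = b i) & U (bshift a) (n, s)) /\
    ((forall s t k k', basic_open d r (a k.+1) (n, s) ->
       basic_open d r (a k'.+1) (n, t) -> N s `&` N t !=set0) /\
    (forall s t k, basic_open d r (a k.+1) (n, s) ->
       N s `<=` N t -> U (bshift a) (n, t)))]); last first.
  apply/seteqP; split=> [a /kapp_domP[h1 h2 h3]|a [h1 [h2 h3]]].
    split=> [m|]; first by have [s []] := h1 m; exists s.
    split=> [s t k k' hk hk'|s t k hk].
      by apply: h2; [exists k|exists k'].
    by apply: h3; exists k.
  apply/kapp_domP; split=> [m|s t [k hk] [k' hk']|s t [k hk]].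
  - by have [s ? ?] := h1 m; exists s.
  - exact: h2 hk hk'.
  - exact: h3 hk.
have oN k y : open (~` [set a : baire | basic_open d r (a k) y]).
  exact: (open_coord (fun j => ~ basic_open d r j y)).
apply: Pi0_and => //; last apply: Pi0_and => //.
- apply: Pi0_forall => // m; apply: open_Pi0 => //.
  rewrite (_ : [set a | _] = \bigcup_(s in [set s | exists b : baire, forall c,
      N s c <-> forall i, (i <= m)%N -> c i = b i])
      [set a | U (bshift a) (n, s)]) //.
  by apply: bigcup_open => s _; exact: open_univ_open.
- do 4!apply: Pi0_forall => // ?; apply: open_Pi0 => //.
  do 2!(apply: open_imply; first exact: oN).
  exact: open_cst.
- do 3!apply: Pi0_forall => // ?; apply: open_Pi0 => //.
  apply: open_imply; first exact: oN.
  apply: open_imply; first exact: (@open_cst _ (~ _)).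
  exact: open_univ_open.
Qed.

Lemma kapp_continuous n (O : set baire) : open O ->
  exists2 W : set baire, open W &
    forall a b, kapp d r (bshift a) n b -> (O b <-> W a).
Proof.
(* The value lies in [O] exactly when the code enumerates some ball included in [O]. *)
move=> oO; exists (\bigcup_(s in [set s | N s `<=` O])
    [set a | U (bshift a) (n, s)]).
  by apply: bigcup_open => s _; exact: open_univ_open.
move=> a b /kappP h; split=> [Ob|[s /= sO /h/sO//]].
have [m hm] := open_cylinder O b oO Ob.
have [s hs] := cylinder_basic_open R b m.
by exists s => [c /hs/hm//|]; apply/h/hs.
Qed.

(** * Complexity of the sets of Borel codes *)

Lemma BC_zeroE : BC d r ozero = [set a | a 0%N = 0%N].
Proof.
apply/seteqP; split=> a; last exact: BC_zero.
move E : ozero => z h; case: h E => // xi a' xi1 _ _ E.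
by move: xi1; rewrite -E leNgt lt_osucc.
Qed.

(** Putting the value [b] before the level [zeta] isolates the union of the lower levels, whose
    preimage can then be taken. *)
Lemma BC_posE xi : oone <= xi -> BC d r xi =
  [set a | a 0%N = 1%N /\ forall n, exists2 b, kapp d r (bshift a) n b &
     exists2 zeta, zeta < xi & BC d r zeta b].
Proof.
move=> xi1; apply/seteqP; split=> [a h|a [a0 h]]; last first.
  apply: BC_pos => // n; have [b kb [zeta zx Bb]] := h n.
  by exists zeta => //; exists b.
case: h xi1 => [a' _|x a' _ a0 h _]; first by rewrite leNgt lt_osucc.
by split=> // n; have [zeta zx [b kb Bb]] := h n; exists b => //; exists zeta.
Qed.

(** Level zero is excluded: its codes start with 0, those of positive level with 1. *)
Lemma BC_le z x : oone <= z -> z <= x -> BC d r z `<=` BC d r x.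
Proof.
move=> z1 zx; rewrite !BC_posE // ?(le_trans z1) // => a [a0 h].
split=> // n; have [b kb [y yz Bb]] := h n.
by exists b => //; exists y => //; exact: lt_le_trans zx.
Qed.

Lemma Pi0_bigcup_BC xi : oone <= xi ->
  (forall z, z < xi -> Pi0 (osucc z) (BC d r z)) ->
  Pi0 (osucc xi) [set b | exists2 z, z < xi & BC d r z b].
Proof.
move=> xi1 IH; have sxi1 : oone < osucc xi by rewrite lt_osuccE.
have [[e xiE]|/forallNP lim] := pselect (exists e, xi = osucc e).
  case: (eqVneq e ozero) xiE => [->|e0] xiE.
    rewrite (_ : [set b | _] = BC d r ozero); last first.
      apply/seteqP; split=> [b [z]|b Bb]; last first.
        by exists ozero; rewrite // xiE lt_osucc.
      rewrite xiE lt_osuccE => z0; rewrite (_ : z = ozero) //.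
      by apply/eqP; rewrite eq_le z0 omega1_botP.
    by apply: open_Pi0 => //; rewrite BC_zeroE; exact: (open_coord [set 0%N]).
  have e1 : oone <= e by rewrite oone_le lt_def e0 omega1_botP.
  have ex : e < xi by rewrite xiE lt_osucc.
  have gt1 : oone < xi by exact: le_lt_trans ex.
  (* Here [BC e] is [Pi0 xi], and adjoining the clopen set [BC ozero] keeps that class. *)
  apply: (Sigma0_le xi) => //; first exact/ltW/lt_osucc.
  rewrite [X in Sigma0 _ X](_ : _ = ~` BC d r e `&` ~` BC d r ozero).
    have [//|] := Sigma0_clopen _ _ (IH e ex) (~` BC d r ozero).
      by rewrite BC_zeroE; exact: (clopen_coord (~` [set 0%N])).
    by rewrite -xiE.
  rewrite -setCU; congr (~` _); apply/seteqP; split=> [b [z]|b [Be|B0]].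
  - rewrite xiE lt_osuccE => ze Bb.
    have [z0|z0] := eqVneq z ozero; first by right; rewrite -z0.
    by left; apply: BC_le ze _ Bb; rewrite oone_le lt_def z0 omega1_botP.
  - by exists e.
  - by exists ozero => //; rewrite -oone_le.
have gt1 : oone < xi.
  by rewrite lt_neqAle xi1 andbT; apply/eqP => /esym/lim.
have sx z : z < xi -> osucc z < xi.
  move=> zx; rewrite lt_neqAle osucc_le // andbT.
  by apply/eqP => /esym/lim.
have /countable_injP[f finj] : countable [set z | z < xi].
  by apply: sub_countable (omega1_countable xi);
    apply: subset_card_le => z /ltW.
(* An enumeration of the ordinals below [xi]; the default [ozero] is itself below [xi]. *)
pose e n := xget ozero [set z | z < xi /\ f z = n].
have ex n : e n < xi.
  by rewrite /e; case: xgetP => [z _ []//|_]; rewrite -oone_le.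
have eK z : z < xi -> e (f z) = z.
  move=> zx; rewrite /e; case: xgetP => [y _ [yx fyz]|/(_ z)[]//].
  by apply: finj; rewrite ?inE.
apply: Sigma0_setC (lt_osucc xi) _; rewrite setCK.
rewrite (_ : [set b | _] = \bigcup_n BC d r (e n)).
  apply: (@Sigma0_bigcup _ _ (fun n => osucc (e n))) => // n.
    by rewrite oone_le_osucc sx.
  exact: IH.
apply/seteqP; split=> [b [z zx Bb]|b [n _ Bb]]; last by exists (e n).
by exists (f z) => //; rewrite eK.
Qed.

Lemma Pi0_BC xi : Pi0 (osucc xi) (BC d r xi).
Proof.
elim/(well_founded_ind omega1_wf): xi => xi IH.
have [->|xi0] := eqVneq xi ozero.
  by rewrite BC_zeroE; apply: Sigma0_open; exact: (open_coord (~` [set 0%N])).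
have xi1 : oone <= xi by rewrite oone_le lt_def xi0 omega1_botP.
have sxi1 : oone < osucc xi by rewrite lt_osuccE.
have PV := Pi0_bigcup_BC xi xi1 IH.
have /choice[B hB] : forall n, exists B : set baire, Pi0 (osucc xi) B /\
    forall a b, kapp d r (bshift a) n b ->
      ((exists2 z, z < xi & BC d r z b) <-> B a).
  move=> n; have [B SB BE] := Pi0_preimage _ (kapp_continuous n) _ _ PV.
  by exists B.
(* [B n] is controlled only on the domain of the partial function, so definedness stays as a
   separate conjunct. *)
rewrite BC_posE // (_ : [set a | _] = [set a | a 0%N = 1%N /\
    forall n, (exists b, kapp d r (bshift a) n b) /\ B n a]).
  apply: Pi0_and => //.
    by apply: open_Pi0 => //; exact: (open_coord [set 1%N]).
  apply: Pi0_forall => // n; apply: Pi0_and => //; first exact: Pi0_kapp_dom.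
  by case: (hB n).
apply/seteqP; split=> a [a0 h]; split=> // n; have [_ Bn] := hB n.
  have [b kb Vb] := h n; split; first by exists b.
  exact/(Bn a b).
by have [[b kb] /(Bn a b kb) Vb] := h n; exists b.
Qed.

(** * Bounds on [rbc] and [apb] *)

Lemma rbc_le xi : rbc d r xi <= osucc xi.
Proof.
have [|_] := @oleastP [set eta | Pi0 eta (BC d r xi)].
  by exists (osucc xi); exact: Pi0_BC.
by apply; exact: Pi0_BC.
Qed.

Lemma apb_le xi : oone <= xi -> apb d r xi <= osucc (osucc xi).
Proof.
elim/(well_founded_ind omega1_wf): xi => xi IH.
rewrite le_eqVlt => /predU1P[<-|xi1].
  by rewrite apb_one oone_le_osucc.
rewrite apb_gt1 //; apply: osucc_mono.
set A := (X in osup X).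
(* Countability makes [osup A] a true supremum rather than a junk value. *)
have cA : countable A.
  apply: sub_countable (card_image_le _ _) _.
  apply: sub_countable (omega1_countable xi); apply: subset_card_le.
  by move=> e [_ /ltW].
have [_] := osupP cA; apply => _ [e [e1 ex] <-].
(* Both entries of the maximum are at most e+2, and e+2 is at most xi+1 because [e < xi]. *)
have sex : osucc (osucc e) <= osucc xi by exact/osucc_mono/osucc_le.
rewrite ge_max (le_trans _ sex) ?IH //=.
by apply: le_trans sex; apply: osucc_mono; exact: rbc_le.
Qed.

End Kapp.

Theorem proposition6 (R : realType) (d : nat * nat -> nat * nat -> R)
    (r : nat -> nat * nat) (pres : recursive_presentation d r)
    (xi : omega1) (xi_ge1 : (oone <= xi)%O) :
  [/\ exists eta : omega1, Pi0 eta (BC d r xi),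
      (rbc d r xi <= osucc xi)%O
    & (apb d r xi <= osucc (osucc xi))%O].
Proof.
split; first by exists (osucc xi); exact: Pi0_BC.
  exact: rbc_le.
exact: apb_le.
Qed.
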